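(* Let $X,Y$ be real Hilbert spaces, $g\in\Gamma_0(X)$, $h\in\Gamma_0(Y)$, $A:X\to Y$ a bounded linear operator with closed range $R(A)$, and $f=g+h\circ A$. Suppose that $\operatorname{argmin} f\neq\emptyset$ and let $\Omega\subset X$. Let $\psi:Y\to]-\infty,+\infty]$ be the function of the Fenchel–Rockafellar dual problem, $\psi(v)=g^*(A^*v)+h^*(-v)$. Assume (a) $0\in\operatorname{sri}(\operatorname{dom} h-A(\operatorname{dom} g))$. Then $\operatorname{argmin}\psi\neq\emptyset$. Moreover, if in addition (b) there is $\bar v\in\operatorname{argmin}\psi$ such that $$0\in\operatorname{sri}\big(\partial g^*(A^*\bar v)-A^{-1}\partial h^*(-\bar v)\big)\quad\text{and}\quad 0\in\operatorname{sri}\big(R(A)-\partial h^*(-\bar v)\big),$$ (c) $g$ is $p_1$-tilt-conditioned on $\Omega$ and $h$ is $p_2$-tilt-conditioned on $A\Omega$ for some $p_1,p_2\ge1$, then $f$ is $p$-conditioned on every bounded subset of $\Omega$, with $p:=\max\{p_1,p_2\}$.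
   Context: $\Gamma_0(X)$ is the set of proper, convex, lower semicontinuous functions $X\to]-\infty,+\infty]$; $g^*$ denotes the Fenchel conjugate, $\partial$ the convex subdifferential, $A^*$ the adjoint, and $A^{-1}$ the preimage under $A$. For a convex set $C$, the strong relative interior is $\operatorname{sri} C=\{x\in C:\operatorname{cone}(C-x)=\overline{\operatorname{span}}(C-x)\}$, where $\operatorname{cone}(D)=\bigcup_{t>0}tD$ and $\overline{\operatorname{span}}$ is the closed linear span. For $f\in\Gamma_0(X)$ with $\operatorname{argmin} f\neq\emptyset$ and $p\in[1,+\infty[$, $f$ is $p$-conditioned on $\Omega$ if there is $\gamma>0$ such that $\frac{\gamma}{p}\operatorname{dist}(x,\operatorname{argmin} f)^p\le f(x)-\inf f$ for all $x\in\Omega\cap\operatorname{dom} f$. A function $g\in\Gamma_0(X)$ is $p$-tilt-conditioned on $\Omega$ if, for every $u\in X$, the function $g+\langle u,\cdot\rangle$ either has no minimizers or is $p$-conditioned on $\Omega$ (and similarly in $Y$). *)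

(* Defs.v *)
From HB Require Import structures.
From mathcomp Require Import all_boot all_order all_algebra.
From mathcomp Require Import all_classical all_reals all_analysis.

Set Implicit Arguments.
Unset Strict Implicit.
Unset Printing Implicit Defensive.

Import Order.TTheory GRing.Theory Num.Theory.
Import numFieldNormedType.Exports.

Local Open Scope classical_set_scope.
Local Open Scope ring_scope.

HB.mixin Record CompleteNormedModule_isHilbert (R : realType) (V : Type)
    of CompleteNormedModule R V := {
  inner : {dot V for (@idfun R)} ;
  sqr_norm_inner : forall x : V, `|x| ^+ 2 = inner x x
}.

#[short(type="hilbertType")]
HB.structure Definition Hilbert (R : realType) :=
  {V of CompleteNormedModule_isHilbert R V & CompleteNormedModule R V}.

Section Sets.
Context {R : realType} {V : hilbertType R}.

Definition minkowski_sub (C D : set V) : set V := [set c - d | c in C & d in D].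

(* The union is over t > 0 only, so that 0 \in cone D iff 0 \in D. *)
Definition cone (D : set V) : set V :=
  \bigcup_(t in [set t : R | 0 < t]) [set t *: d | d in D].

Definition lin_span (D : set V) : set V :=
  smallest [set S : set V | submod_closed [in S]] D.

Definition sri (C : set V) : set V :=
  [set x | C x /\ cone [set c - x | c in C] =
                  closure (lin_span [set c - x | c in C])].

End Sets.

Section Functions.
Context {R : realType} {V : hilbertType R}.
Implicit Types f : V -> \bar R.
Local Open Scope ereal_scope.

Definition edom f : set V := [set x | f x < +oo].

Definition proper f := (forall x, f x != -oo) /\ edom f !=set0.

Definition econvex f := forall (x y : V) (t : R), (0 < t < 1)%R ->
  f (t *: x + (1 - t) *: y)%R <= t%:E * f x + (1 - t)%:E * f y.

Definition Gamma0 f := [/\ proper f, econvex f & lower_semicontinuous f].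

(* The function identically +oo has no minimizer. *)
Definition argmin f : set V := [set x | edom f x /\ forall y, f x <= f y].

Definition conjugate f (u : V) : \bar R :=
  ereal_sup (range (fun x : V => (inner u x)%:E - f x)).

Definition subdiff f (x : V) : set V :=
  [set u | forall y, f x + (inner u (y - x)%R)%:E <= f y].

Definition conditioned (p : R) f (Omega : set V) :=
  exists2 gamma : R, (0 < gamma)%R &
    forall x, (Omega `&` edom f) x ->
      (gamma / p)%:E * edist_inf (argmin f) x `^ p
        <= f x - ereal_inf (range f).

Definition tilt_conditioned (p : R) f (Omega : set V) :=
  forall u : V, let fu := fun x => f x + (inner u x)%:E in
    argmin fu = set0 \/ conditioned p fu Omega.

End Functions.

(* For bounded linear A the set below is a singleton, by the Riesz representation
   theorem; the default value 0 is then irrelevant. *)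
Definition adjoint {R : realType} {X Y : hilbertType R} (A : X -> Y) (v : Y) :
    X :=
  xget 0 [set w | forall x, inner (A x) v = inner x w].

(* Main.v *)
Require Import Defs.
From HB Require Import structures.
From mathcomp Require Import all_boot all_order all_algebra.
From mathcomp Require Import all_classical all_reals all_analysis.
From mathcomp Require Import ring lra.

Set Implicit Arguments.
Unset Strict Implicit.
Unset Printing Implicit Defensive.

Import Order.TTheory GRing.Theory Num.Theory.
Import numFieldNormedType.Exports.

Local Open Scope classical_set_scope.
Local Open Scope ring_scope.

(** The dual problem attains the value [- inf f] by strong duality, which is the
first claim.  Let now [v] be the dual solution of the qualification conditions
and put [w = adjoint A v].  As [psi v = - inf f], the gap [f x - inf f] splits
as the gap of [g - <w, .>] at [x] plus the gap of [h + <v, .>] at [A x], each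
gap being measured from the respective infimum.  By Fenchel-Moreau the minimizers of
these two tilted functions are [C = subdiff (conjugate g) w] and
[D = subdiff (conjugate h) (- v)] ([argmin_tilt]), and every point of [C] sent
into [D] by [A] minimizes [f].  Tilt conditioning bounds the two gaps below by
powers of [dist(x, C)] and [dist(A x, D)] ([tilt_conditioned_growth]).  It then
remains to bound [dist(x, argmin f)], for bounded [x], by a multiple of the
larger of these two distances; this is where the last two qualification
conditions enter ([bounded_regularity_preimage]).  On a bounded set a power of a
distance is dominated, up to a constant, by any smaller power, hence the
exponent [max p1 p2] ([growth_combine]).

Two tools carry the argument.

The first is [proximal_point]: minimizing [s + |y - x|^2 / 2] over a convex set
of pairs [(y, s)] produces, by the parallelogram identity, a Cauchy
minimizing sequence, and its limit satisfies a subgradient inequality.  Applied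
to a closed subspace it gives the orthogonal projection; to an epigraph,
Fenchel-Moreau ([subdiff_conjugateP]); to the cone generated by a convex set
lying above [- K |y|], a linear functional below that set ([linear_minorant]).
The last fact yields both the Riesz representation behind [adjoint] and the
subgradient of the value function at the origin that solves the dual problem
([strong_duality]).

The second is the Robinson-Ursescu theorem [robinson_ursescu], an open mapping
theorem for closed convex multifunctions: if the range absorbs the space, it
contains a ball whose points all have uniformly bounded preimages.  A set with
[0] in its strong relative interior absorbs a closed subspace, and composing the
multifunction with the orthogonal projection onto that subspace transfers the
theorem to it.  It provides the upper bound on the value function near the
origin, the bounded linear regularity of pairs of sets, and the bounded right
inverse of an operator with closed range. *)

(** * Inner products *)

Section Inner.
Context {R : realType} {V : hilbertType R}.
Implicit Types x y z : V.

Lemma innerC x y : inner x y = inner y x.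
Proof. by rewrite (@hermC _ _ _ _ inner) expr0 mul1r. Qed.

Lemma innerDl x y z : inner (x + y) z = inner x z + inner y z.
Proof. exact: linearDl. Qed.

Lemma innerDr x y z : inner z (x + y) = inner z x + inner z y.
Proof. exact: linearDr. Qed.

Lemma innerNl x y : inner (- x) y = - inner x y.
Proof. exact: linearNl. Qed.

Lemma innerNr x y : inner x (- y) = - inner x y.
Proof. exact: linearNr. Qed.

Lemma innerZl a x y : inner (a *: x) y = a * inner x y.
Proof. exact: linearZl_LR. Qed.

Lemma innerZr a x y : inner x (a *: y) = a * inner x y.
Proof. exact: linearZr_LR. Qed.

Definition inner_simp := (innerDl, innerDr, innerNl, innerNr, innerZl, innerZr).

Lemma inner0l x : inner 0 x = 0.
Proof. exact: linear0l. Qed.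

Lemma inner_ge0 x : 0 <= inner x x.
Proof. by rewrite -sqr_norm_inner sqr_ge0. Qed.

Lemma inner_eq0 x : inner x x = 0 -> x = 0.
Proof. by rewrite -sqr_norm_inner => /eqP; rewrite sqrf_eq0 normr_eq0 => /eqP. Qed.

End Inner.

(** * Minimization with a quadratic penalty *)

Lemma convex_comb_sub (R : realType) (V : lmodType R) (t : R) (x a b : V) :
  t *: a + (1 - t) *: b - x = t *: (a - x) + (1 - t) *: (b - x).
Proof.
rewrite !scalerBr addrACA -opprD -scalerDl.
by rewrite [t + _]addrC subrK scale1r.
Qed.

Section Limits.
Context {R : realType}.

(** The bound on the distance to the limit is what keeps the solution built in
[robinson_ursescu] inside the unit ball around [z0]. *)
Lemma cvg_of_modulus (V : completeNormedModType R) (u : nat -> V) (e : nat -> R) :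
  e @ \oo --> 0 -> (forall n m, (n <= m)%N -> `|u m - u n| <= e n) ->
  exists2 l : V, u @ \oo --> l & forall n, `|l - u n| <= e n.
Proof.
move=> e0 ue.
have cu : cvg (u @ \oo).
  apply/cauchy_cvgP/cauchy_exP => d d0.
  have [N _ /(_ N (leqnn N))] := cvgr_lt _ e0 _ d0.
  move=> /= eN; exists (u N), N => // m /= Nm.
  by rewrite -ball_normE /= distrC (le_lt_trans _ eN)// ue.
pose l := lim (u @ \oo); have ul : u @ \oo --> l := cu.
exists l => // n.
have cn : (fun m => `|u m - u n|) @ \oo --> `|l - u n|.
  by apply: cvg_norm; apply: cvgB => //; exact: cvg_cst.
rewrite -(cvg_lim _ cn)//; apply: limr_le; first by apply/cvg_ex; exists `|l - u n|; exact: cn.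
by exists n => // m /= nm; exact: ue.
Qed.

End Limits.

Section QuadraticMin.
Context {R : realType} {V : hilbertType R}.

Lemma sqr_norm_convex (t : R) (a b : V) :
  `|t *: a + (1 - t) *: b| ^+ 2 =
  t * `|a| ^+ 2 + (1 - t) * `|b| ^+ 2 - t * (1 - t) * `|a - b| ^+ 2.
Proof. by rewrite !sqr_norm_inner !inner_simp (innerC b a); ring. Qed.

Lemma sqr_normD (a b : V) :
  `|a + b| ^+ 2 = `|a| ^+ 2 + 2 * inner a b + `|b| ^+ 2.
Proof. by rewrite !sqr_norm_inner !inner_simp (innerC b a); ring. Qed.

Definition convex_pair (S : set (V * R)) :=
  forall p q (t : R), 0 < t < 1 -> S p -> S q ->
    S (t *: p.1 + (1 - t) *: q.1, t * p.2 + (1 - t) * q.2).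

(** The penalty makes the objective strongly convex, so near-minimizers are close
to each other and a minimizing sequence converges, even though [S] need not be
closed.  The inequality is the first-order optimality condition at the limit:
when [S] is the epigraph of a lower semicontinuous function, it says that
[x - p0.1] is a subgradient at [p0.1]. *)
Lemma proximal_point (S : set (V * R)) (x : V) (b : R) :
  S !=set0 ->
  convex_pair S ->
  (forall p, S p -> b <= p.2 + `|p.1 - x| ^+ 2 / 2) ->
  exists2 p0 : V * R, closure S p0 &
    forall p, S p -> p0.2 + inner (x - p0.1) (p.1 - p0.1) <= p.2.
Proof.
move=> [p1 Sp1] Sconv bS.
pose J (p : V * R) := p.2 + `|p.1 - x| ^+ 2 / 2.
have JS0 : has_inf (J @` S).
  by split; [exists (J p1), p1 | exists b => _ [p Sp <-]; exact: bS].
set d := inf (J @` S).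
have dJ p : S p -> d <= J p by move=> Sp; apply: ge_inf; [case: JS0|exists p].
have near_inf n : exists q, S q /\ J q < d + n.+1%:R^-1 ^+ 2.
  have e0 : 0 < n.+1%:R^-1 ^+ 2 :> R by rewrite exprn_gt0 ?invr_gt0.
  by have [_ [q Sq <-] ltq] := inf_adherent e0 JS0; exists q.
have [u uP] := choice near_inf.
have Su n : S (u n) := (uP n).1.
have [w0 cw _] : exists2 w0 : V, (fun n => (u n).1) @ \oo --> w0 &
    forall n, `|w0 - (u n).1| <= 3 * n.+1%:R^-1.
  apply: cvg_of_modulus => [|n m nm].
    by rewrite -[X in _ --> X](mulr0 3); apply: cvgMr; exact: cvg_harmonic.
  (* The midpoint of two near-minimizers cannot beat the infimum [d]. *)
  have half01 : 0 < (2^-1 : R) < 1 by apply/andP; split; lra.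
  have := dJ _ (Sconv _ _ _ half01 (Su m) (Su n)).
  rewrite /J /= convex_comb_sub sqr_norm_convex.
  have -> : (u m).1 - x - ((u n).1 - x) = (u m).1 - (u n).1.
    by rewrite opprB addrA subrK.
  have := (uP n).2; have := (uP m).2; rewrite /J.
  have le_inv : m.+1%:R^-1 <= n.+1%:R^-1 :> R by rewrite lef_pV2 ?posrE ?ler_nat.
  have inv_ge0 : 0 <= m.+1%:R^-1 :> R by rewrite invr_ge0.
  move: le_inv inv_ge0 (normr_ge0 ((u m).1 - (u n).1)).
  move: (m.+1%:R^-1) (n.+1%:R^-1) `|_ - (u n).1| => im in_ D le_inv i0 D0 Hm Hn H.
  have le2 : im ^+ 2 <= in_ ^+ 2 by rewrite lerXn2r ?nnegrE// (le_trans i0).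
  have D2 : D ^+ 2 <= (3 * in_) ^+ 2 by nra.
  by rewrite -ler_sqr ?nnegrE // mulr_ge0 // (le_trans i0).
pose s0 := d - `|w0 - x| ^+ 2 / 2.
have cnorm (a : V) (v : nat -> V) : v @ \oo --> a ->
    (fun n => `|v n - x| ^+ 2 / 2) @ \oo --> `|a - x| ^+ 2 / 2.
  move=> va; apply: cvgMl.
  have nva : (fun n => `|v n - x|) @ \oo --> `|a - x|.
    by apply: cvg_norm; apply: cvgB => //; exact: cvg_cst.
  by under eq_fun do rewrite expr2; rewrite expr2; exact: cvgM.
have cJ : (fun n => J (u n)) @ \oo --> d.
  apply: (@squeeze_cvgr _ _ _ _ (fun=> d) (fun n => d + n.+1%:R^-1 ^+ 2)).
  - by apply: nearW => n; rewrite dJ //= ltW // (uP n).2.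
  - exact: cvg_cst.
  - have : (fun n => d + harmonic n * harmonic n) @ \oo --> d + 0 * 0.
      by apply: cvgD; [exact: cvg_cst|apply: cvgM; exact: cvg_harmonic].
    rewrite mulr0 addr0; apply: cvg_trans; apply: near_eq_cvg.
    by apply: nearW => n; rewrite expr2.
have cs : (fun n => (u n).2) @ \oo --> s0.
  have -> : (fun n => (u n).2) = (fun n => J (u n) - `|(u n).1 - x| ^+ 2 / 2).
    by apply/funext => n; rewrite /J addrK.
  by apply: cvgB => //; exact: cnorm.
exists (w0, s0).
  apply: (@closed_cvg _ _ \oo _ u).
  - exact: closed_closure.
  - by apply: nearW => n; exact: subset_closure.
  - have -> : u = (fun n => ((u n).1, (u n).2)).
      by apply/funext => n; rewrite -surjective_pairing.
    exact: (cvg_pair cw cs).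
move=> [w s] Sws /=.
(* Moving from the limit towards [w] by a small [t] does not go below [d]. *)
have key (t : R) : 0 < t < 1 ->
    0 <= t * (s - s0 - inner (x - w0) (w - w0)) + t ^+ 2 * (`|w - w0| ^+ 2 / 2).
  move=> t01.
  have c : (fun n => J (t *: w + (1 - t) *: (u n).1, t * s + (1 - t) * (u n).2))
      @ \oo --> J (t *: w + (1 - t) *: w0, t * s + (1 - t) * s0).
    apply: cvgD => /=.
      by apply: cvgD; [exact: cvg_cst|apply: cvgMr; exact: cs].
    apply: cnorm; apply: cvgD; [exact: cvg_cst|apply: cvgZl_tmp; exact: cw].
  have : d <= J (t *: w + (1 - t) *: w0, t * s + (1 - t) * s0).
    rewrite -(cvg_lim _ c)//; apply: limr_ge; first by apply/cvg_ex; eexists; exact: c.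
    by apply: nearW => n; apply: dJ; exact: (Sconv (w, s)).
  rewrite /J /= -subr_ge0 => /le_trans; apply.
  rewrite le_eqVlt; apply/orP; left; apply/eqP.
  have -> : d = s0 + `|w0 - x| ^+ 2 / 2 by rewrite /s0; ring.
  have -> : t *: w + (1 - t) *: w0 - x = t *: (w - w0) + (w0 - x).
    by rewrite scalerBr scalerBl scale1r (addrC w0 (- _)) !addrA.
  rewrite (sqr_normD (t *: _)) innerZl normrZ exprMn real_normK ?num_real//.
  have -> : inner (w - w0) (w0 - x) = - inner (x - w0) (w - w0).
    by rewrite -[w0 - x]opprB innerNr innerC.
  by field.
rewrite leNgt; apply/negP => lts.
set c := s - s0 - inner (x - w0) (w - w0) in key.
have c0 : c < 0 by rewrite /c; lra.
set n2 := `|w - w0| ^+ 2 / 2 in key.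
have n20 : 0 <= n2 by rewrite divr_ge0 ?sqr_ge0.
(* A step for which the quadratic term is beaten by the linear term [t * c]. *)
pose t := - c / (2 * (n2 - c) + 1).
have den : 0 < 2 * (n2 - c) + 1 by lra.
have t0 : 0 < t by rewrite divr_gt0 ?oppr_gt0.
have t1 : t < 1 by rewrite ltr_pdivrMr //; lra.
have := key t; rewrite t0 t1 => /(_ isT).
rewrite expr2 -mulrA -mulrDr pmulr_rge0 //.
have : t * (2 * (n2 - c) + 1) = - c by rewrite divfK ?gt_eqF.
nra.
Qed.

End QuadraticMin.

(** * Projections, linear minorants, adjoints and conjugates *)

Lemma cauchy_schwarz (R : realType) (V : hilbertType R) (x y : V) :
  `|inner x y| <= `|x| * `|y|.
Proof.
suff le (a b : V) : inner a b <= `|a| * `|b|.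
  by rewrite ler_norml le andbT lerNl -innerNl -(normrN x) le.
have [->|a0] := eqVneq a 0; first by rewrite inner0l normr0 mul0r.
have [->|b0] := eqVneq b 0; first by rewrite innerC inner0l normr0 mulr0.
have ab0 : 0 < `|a| * `|b| by rewrite mulr_gt0 ?normr_gt0.
have := inner_ge0 (`|b| *: a - `|a| *: b).
rewrite !inner_simp -!sqr_norm_inner (innerC b a) => H.
by rewrite -(ler_pM2l ab0); lra.
Qed.

Section Minorants.
Context {R : realType} {V : hilbertType R}.

Definition closed_subspace (L : set V) := closed L /\ submod_closed [in L].

(** The projection of [x] is the proximal point of the set [L * {0}]; the
optimality condition in both directions [w] and [- w] is orthogonality, which
determines the projection and makes it linear. *)
Lemma orthogonal_projection (L : set V) : closed_subspace L ->
  exists P : {linear V -> V},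
    [/\ forall x, L (P x), forall x, L x -> P x = x & forall x, `|P x| <= `|x|].
Proof.
move=> [clL [/set_mem L0 linL]].
have Llin a u v : L u -> L v -> L (a *: u + v).
  by move=> Lu Lv; have := linL a u v; rewrite !inE; exact.
suff H x : exists y, L y /\ forall w, L w -> inner (x - y) w = 0.
  have [P PP] := choice H.
  have LP x : L (P x) := (PP x).1.
  have PO x w : L w -> inner (x - P x) w = 0 by exact: (PP x).2.
  have Puniq x y : L y -> (forall w, L w -> inner (x - y) w = 0) -> P x = y.
    move=> Ly yO; apply/eqP; rewrite -subr_eq0; apply/eqP/inner_eq0.
    have Ld : L (P x - y).
      by rewrite addrC -scaleN1r; exact: Llin.
    move: (yO _ Ld) (PO x _ Ld); set d := P x - y.
    by rewrite {3}/d !innerDl !innerNl; lra.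
  have Plin : linear P.
    move=> a x y; apply: Puniq; first exact: Llin.
    move=> w Lw; rewrite opprD addrACA -scalerBr innerDl innerZl.
    by rewrite !PO// mulr0 addr0.
  pose Pl : {linear V -> V} :=
    HB.pack P (GRing.isLinear.Build R V V _ P Plin).
  exists Pl; split=> //= x => [Lx|].
    by apply: Puniq => // w _; rewrite subrr inner0l.
  rewrite -ler_sqr ?nnegrE// -{2}(subrK (P x) x) sqr_normD PO//.
  by rewrite mulr0 addr0 lerDr sqr_ge0.
pose S := [set p : V * R | L p.1 /\ p.2 = 0].
have [[w0 s0] S0 /= minS] : exists2 p0 : V * R, closure S p0 &
    forall p, S p -> p0.2 + inner (x - p0.1) (p.1 - p0.1) <= p.2.
  apply: (@proximal_point _ _ _ _ 0).
  - by exists (0, 0).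
  - move=> [u a] [v b] t _ [/= Lu ->] [/= Lv ->]; split=> /=; last by ring.
    by apply: (Llin) => //; rewrite -[X in L X]addr0; apply: (Llin).
  - by move=> [u a] [/= _ ->]; rewrite add0r divr_ge0 ?sqr_ge0.
have [/= Lw0 s00] : S (w0, s0).
  have <- : closure S = S.
    apply/esym/closure_id; apply: closedI.
      by apply: (@preimage_closed _ _ fst L) => // p _; exact: cvg_fst.
    apply: (@preimage_closed _ _ snd [set 0]) => [p _|]; first exact: cvg_snd.
    exact: closed_eq.
  exact: S0.
exists w0; split => // w Lw.
have := minS (-1 *: w + w0, 0) (conj (Llin _ _ _ Lw Lw0) erefl).
have := minS (w + w0, 0); rewrite -[w in w + w0]scale1r.
move=> /(_ (conj (Llin _ _ _ Lw Lw0) erefl)) /=.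
rewrite !addrK !innerZr; lra.
Qed.

(** Replace [E] by the cone it generates and take the proximal point of the origin:
its subgradient inequality is invariant under scaling, so the constant term must
drop out and [- w0] is the required functional.  The lower bound by [- K |y|]
is what makes the penalized problem bounded below. *)
Lemma linear_minorant (E : set (V * R)) (K : R) : E !=set0 ->
  convex_pair E ->
  (forall p, E p -> - (K * `|p.1|) <= p.2) ->
  exists v, forall p, E p -> inner v p.1 <= p.2.
Proof.
move=> [e Ee] Econv EK.
pose S := [set p : V * R | exists2 t, 0 < t &
  exists2 q, E q & p = (t *: q.1, t * q.2)].
have [[w0 s0] _ /= minS] : exists2 p0 : V * R, closure S p0 &
    forall p, S p -> p0.2 + inner (0 - p0.1) (p.1 - p0.1) <= p.2.
  apply: (@proximal_point _ _ _ _ (- (K ^+ 2 / 2))).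
  - by exists (1 *: e.1, 1 * e.2); exists 1 => //; exists e.
  - move=> _ _ a /andP[a0 a1] [s sp [p Ep ->]] [t tp [q Eq ->]] /=.
    have a1' : 0 < 1 - a by rewrite subr_gt0.
    have asp : 0 < a * s by rewrite mulr_gt0.
    have atp : 0 < (1 - a) * t by rewrite mulr_gt0.
    pose T := a * s + (1 - a) * t.
    have T0 : 0 < T by rewrite addr_gt0.
    have TU : T != 0 by rewrite gt_eqF.
    exists T => //; pose r := a * s / T.
    have rT : 1 - r = (1 - a) * t / T by rewrite /r /T in TU *; field.
    exists (r *: p.1 + (1 - r) *: q.1, r * p.2 + (1 - r) * q.2).
      by apply: Econv => //; rewrite divr_gt0//= -subr_gt0 rT divr_gt0.
    rewrite rT /r /=; congr pair; last by field.
    rewrite scalerDr !scalerA; congr (_ *: _ + _ *: _); by field.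
  - move=> _ [t t0 [q Eq ->]] /=; rewrite subr0 normrZ gtr0_norm//.
    have := EK _ Eq; rewrite -(ler_pM2l t0).
    have : 0 <= (t * `|q.1| - K) ^+ 2 by rewrite sqr_ge0.
    by move=> ? ?; lra.
exists (- w0) => q Eq.
have H t : 0 < t -> s0 + inner w0 w0 <= t * (q.2 + inner w0 q.1).
  move=> t0; have := minS (t *: q.1, t * q.2).
  move=> /(_ (ex_intro2 _ _ t t0 (ex_intro2 _ _ q Eq erefl))) /=.
  by rewrite sub0r !inner_simp; lra.
rewrite innerNl lerNl -subr_ge0 opprK leNgt; apply/negP => lt0.
rewrite addrC in lt0; set c := q.2 + inner w0 q.1 in lt0; set d := s0 + _ in H.
(* Scaling far enough along [q] makes the right-hand side of [H] less than [d]. *)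
have t0 : 0 < (`|d| + 1) / - c by rewrite divr_gt0 ?oppr_gt0// ltr_wpDl.
have := H _ t0; rewrite -/c.
have -> : (`|d| + 1) / - c * c = - (`|d| + 1).
  by field; rewrite lt_eqF.
have := ler_norm (- d); rewrite normrN; lra.
Qed.

End Minorants.

(** Riesz representation: the graph of the bounded functional [x |-> <A x, v>] has
a linear minorant, and a linear functional below another one equals it. *)
Lemma adjointP (R : realType) (X Y : hilbertType R) (A : {linear X -> Y}) :
  (exists M : R, forall x, `|A x| <= M * `|x|) ->
  forall x v, inner (A x) v = inner x (adjoint A v).
Proof.
move=> [M AM] x v; rewrite /adjoint; case: xgetP => [w _ -> //|].
pose E := [set p : X * R | p.2 = inner (A p.1) v].
have [w wP] : exists w, forall p, E p -> inner w p.1 <= p.2.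
  apply: (@linear_minorant _ _ _ (M * `|v|)).
  - by exists (0, inner (A 0) v).
  - move=> p q t _; rewrite /E /= => -> ->.
    by rewrite linearD !linearZ !inner_simp.
  - move=> [y s]; rewrite /E /= => ->.
    have := cauchy_schwarz (A y) v; rewrite ler_norml => /andP[le _].
    apply: le_trans le; rewrite lerN2 mulrAC ler_wpM2r //.
move=> /(_ w); case=> y /=; apply: le_anti; apply/andP; split.
  have := wP (- y, inner (A (- y)) v) erefl => /=.
  by rewrite (linearN A) !inner_simp lerN2 (innerC w).
by have := wP (y, inner (A y) v) erefl; rewrite /= (innerC w).
Qed.

Section Conjugate.
Context {R : realType} {V : hilbertType R}.
Implicit Types g : V -> \bar R.
Local Open Scope ereal_scope.

Lemma conjugate_ge g u x : (inner u x)%:E - g x <= conjugate g u.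
Proof. by apply: ereal_sup_ubound; exists x. Qed.

Lemma closed_epigraph g : lower_semicontinuous g ->
  closed [set p : V * R | g p.1 <= p.2%:E].
Proof.
move=> lsc; rewrite -openC openE => -[x r] /= /negP; rewrite -ltNge => rg.
have [a ra ag] : exists2 a, (r < a)%R & a%:E < g x.
  move: rg; case: (g x) => [s| |]; rewrite ?lte_fin //.
  - by move=> rs; exists ((r + s) / 2)%R; rewrite ?lte_fin; lra.
  - by move=> _; exists (r + 1)%R; rewrite ?ltry//; lra.
have [U Ux Ug] := lsc _ _ ag.
have Ir : nbhs r [set s | (s < a)%R] by apply: open_nbhs_nbhs; split => //; exact: open_lt.
exists (U, [set s | (s < a)%R]) => // -[y s] [/= Uy sa] /=.
by apply/negP; rewrite -ltNge (lt_trans _ (Ug _ Uy))// lte_fin.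
Qed.

(** The direct implication is the Fenchel-Moreau theorem in local form.  With
[y] the proximal point of [x + w] for the epigraph of [g], the vector
[x + w - y] is a subgradient of [g] at [y].  Comparing the value of [conjugate g]
there with the lower bound given by [x] forces [|x - y|^2 <= 0], so [x = y] and
the pair [(x, s)] lies in the epigraph. *)
Lemma subdiff_conjugateP g (w x : V) (a : R) : Gamma0 g ->
  conjugate g w = a%:E ->
  subdiff (conjugate g) w x <-> g x <= (inner w x - a)%:E.
Proof.
move=> [[gNy [z gz]] gconv glsc] gw.
have ge y s : g y <= s%:E -> (inner w y - a <= s)%R.
  move=> gys; have := conjugate_ge g w y; rewrite gw.
  move: gys (gNy y); case: (g y) => [r| |]//; rewrite -?EFinB ?lee_fin.
  by move=> rs _ le; lra.
split; last first.
  move=> le u; rewrite gw; apply: le_trans (conjugate_ge g u x).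
  move: le (gNy x); case: (g x) => [r| |]//; rewrite lee_fin => le _.
  by rewrite -EFinD -EFinB lee_fin !inner_simp !(innerC x); lra.
move=> sub.
have fin y : g y < +oo -> exists2 r, g y = r%:E & (inner w y - a <= r)%R.
  by move: (gNy y) (ge y); case: (g y) => [r| |]// _ le _; exists r => //; exact: le.
pose S := [set p : V * R | g p.1 <= p.2%:E].
have [[y s] S0 /= minS] : exists2 p0 : V * R, closure S p0 &
    forall p, S p -> (p0.2 + inner (x + w - p0.1) (p.1 - p0.1) <= p.2)%R.
  apply: (@proximal_point _ _ _ _ (inner w x - a)%R).
  - by have [r gr _] := fin _ gz; exists (z, r); rewrite /S /= gr.
  - move=> [y1 r1] [y2 r2] t t01 /= S1 S2; apply: (le_trans (gconv _ _ _ t01)).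
    move/andP: t01 => [t0 t1]; rewrite [leRHS]EFinD !EFinM.
    by rewrite leeD// lee_wpmul2l// lee_fin; lra.
  (* Up to a constant the penalty at [x + w] is the penalty at [x] minus
     [<w, y>], and [g - <w, .>] is bounded below by [- a]. *)
  - move=> [y s] /ge /= le.
    have := sqr_ge0 (`|y - x - w|%R : R); have -> : (y - (x + w) = y - x - w)%R by rewrite opprD addrA.
    have -> : (`|y - x - w| ^+ 2 = `|y - x| ^+ 2 - 2 * (inner w y - inner w x) + `|w| ^+ 2)%R.
      by rewrite sqr_normD normrN innerNr innerC !inner_simp; ring.
    have := sqr_ge0 (`|y - x|%R : R); have := sqr_ge0 (`|w|%R : R); lra.
have /= gys : S (y, s).
  have <- : closure S = S by apply/esym/closure_id; exact: closed_epigraph.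
  exact: S0.
have gu : conjugate g (x + w - y)%R <= (inner (x + w - y) y - s)%:E.
  apply: ge_ereal_sup => _ [z' _ <-].
  have [/fin[r gr _]|] := boolP (g z' < +oo); last first.
    by rewrite -leNgt leye_eq => /eqP ->; rewrite leNye.
  rewrite gr -EFinB lee_fin; have /= := minS (z', r); rewrite /S /= gr lexx => /(_ isT).
  by rewrite innerDr innerNr; lra.
have := le_trans (sub (x + w - y)%R) gu; rewrite gw -EFinD lee_fin.
have -> : (x + w - y - w = x - y)%R by rewrite addrAC addrK.
have /= sge := ge _ _ gys.
have -> : (inner x (x - y) = inner (x - y) (x - y) + inner (x - y) y)%R.
  by rewrite -innerDr subrK innerC.
rewrite (addrAC x) (innerDl (x - y)%R w) => le.
have xy : (x - y = 0)%R.
  by apply: inner_eq0; apply: le_anti; rewrite inner_ge0 andbT; lra.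
move: le; rewrite xy !inner0l => le.
have -> : x = y by apply/eqP; rewrite -subr_eq0 xy.
by apply: (le_trans gys); rewrite lee_fin /=; lra.
Qed.

End Conjugate.

(** * The Robinson-Ursescu theorem *)

(** The endpoints are left out, as in [econvex]. *)
Definition convex (R : realType) (V : lmodType R) (S : set V) :=
  forall (t : R) x y, 0 < t < 1 -> S x -> S y -> S (t *: x + (1 - t) *: y).

Section OpenMapping.
Context {R : realType}.

Lemma closureP_norm (V : normedModType R) (S : set V) (x : V) :
  closure S x <-> forall e : R, 0 < e -> exists2 y, S y & `|x - y| < e.
Proof.
split=> [clSx e e0|H U /nbhs_ballP[e /= e0 eU]].
  have [y [Sy xy]] := clSx _ (nbhsx_ballx x e e0).
  by exists y => //; move: xy; rewrite -ball_normE.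
have [y Sy xy] := H _ e0; exists y; split => //; apply: eU.
by rewrite -ball_normE.
Qed.

Lemma closure_convex (V : normedModType R) (S : set V) :
  convex S -> convex (closure S).
Proof.
move=> cS t x y /[dup] t01 /andP[t0 t1] /closureP_norm clx /closureP_norm cly.
apply/closureP_norm => e e0.
have [x' Sx' xx'] := clx _ e0; have [y' Sy' yy'] := cly _ e0.
exists (t *: x' + (1 - t) *: y'); first exact: cS.
rewrite opprD addrACA -!scalerBr (le_lt_trans (ler_normD _ _))// !normrZ.
by rewrite !gtr0_norm ?subr_gt0//; nra.
Qed.

Lemma convex_segment (V : lmodType R) (S : set V) (c x : V) (t : R) :
  convex S -> S c -> S x -> 0 <= t <= 1 -> S (c + t *: (x - c)).
Proof.
move=> cS Sc Sx /andP[].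
rewrite le_eqVlt => /predU1P[<- _|t0]; first by rewrite scale0r addr0.
rewrite le_eqVlt => /predU1P[->|t1]; first by rewrite scale1r addrC subrK.
have -> : c + t *: (x - c) = t *: x + (1 - t) *: c.
  by rewrite scalerBr scalerBl scale1r addrCA.
by apply: cS => //; rewrite t0.
Qed.

(** The dilates of [F] cover the space, so by Baire some closed dilate, hence
[closure F], contains a ball around some [w0].  As [F] also contains a positive
multiple of [- w0], a convex combination recentres the ball at the origin. *)
Lemma baire_absorbing (W : completeNormedModType R) (F : set W) :
  convex F -> F 0 -> (forall w, exists2 t : R, 0 < t & F (t *: w)) ->
  exists2 rho : R, 0 < rho & forall w, `|w| < rho -> closure F w.
Proof.
move=> cF F0 absF.
have shrink s t w : F (t *: w) -> 0 <= s <= t -> F (s *: w).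
  move=> Ft /andP[s0]; rewrite le_eqVlt => /predU1P[->//|st].
  have t0 : 0 < t by exact: le_lt_trans st.
  have := @convex_segment _ F 0 (t *: w) (s / t) cF F0 Ft.
  rewrite add0r subr0 scalerA divfK ?gt_eqF//; apply.
  by rewrite divr_ge0 ?(ltW t0)//= ler_pdivrMr// mul1r ltW.
pose C n := [set w | closure F (n.+1%:R^-1 *: w)].
have clC n : closed (C n).
  apply: (@preimage_closed _ _ (fun w => n.+1%:R^-1 *: w) (closure F)).
    by move=> w _; apply: cvgZl_tmp; exact: cvg_id.
  exact: closed_closure.
have [n nd] : exists n, ~ dense (~` C n).
  apply/not_existsP => dC.
  have : forall n, open (~` C n) /\ dense (~` C n).
    by move=> n; split; [exact: closed_openC|apply: contrapT; exact: dC].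
  move=> /Baire /(_ setT) [||w [_ wC]]; [by exists 0|exact: openT|].
  have [t t0 Ftw] := absF w.
  have [n /ltW nt] : exists n : nat, n.+1%:R^-1 < t.
    exists (Num.truncn t^-1).
    by rewrite -[ltRHS]invrK ltf_pV2 ?posrE ?invr_gt0// truncnS_gt.
  apply: (wC n I); apply: subset_closure.
  by apply: shrink Ftw _; rewrite nt invr_ge0 ler0n.
have [w0 [r r0 ball_r]] : exists w0 : W, exists2 r : R, 0 < r &
    forall w, `|w| < r -> closure F (w0 + w).
  have [U [w [Uw oU UC]]] : exists (U : set W) w, [/\ U w, open U & U `<=` C n].
    apply: contrapT => H; apply: nd => U [w Uw] oU.
    apply: contrapT => /set0P /negP/negPn /eqP H0.
    apply: H; exists U, w; split=> // z Uz; apply: contrapT => Cz.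
    by have : (U `&` ~` C n) z by []; rewrite H0.
  have /nbhs_ballP[e /= e0 eU] : nbhs w U by exact: open_nbhs_nbhs.
  exists (n.+1%:R^-1 *: w); exists (n.+1%:R^-1 * e) => [|z ze].
    by rewrite mulr_gt0 ?invr_gt0.
  have n0 : n.+1%:R != 0 :> R by rewrite pnatr_eq0.
  have -> : n.+1%:R^-1 *: w + z = n.+1%:R^-1 *: (w + n.+1%:R *: z).
    by rewrite scalerDr scalerA mulVf// scale1r.
  apply: UC; apply: eU; rewrite -ball_normE /ball_/= opprD addrA subrr sub0r.
  by rewrite normrN normrZ normr_nat -ltr_pdivlMl.
have [t t0 Ft] := absF (- w0).
(* The weight for which [l *: w0] and [(1 - l) *: (t *: - w0)] cancel. *)
pose l := t / (1 + t).
have t1 : 0 < 1 + t by rewrite ltr_wpDr// ltW.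
have tU : 1 + t != 0 by rewrite gt_eqF.
have l0 : 0 < l by rewrite divr_gt0.
have l1 : l < 1 by rewrite ltr_pdivrMr// mul1r ltrDr.
have lE : (1 - l) * t = l by rewrite /l; field.
exists (l * r) => [|w wr]; first by rewrite mulr_gt0.
have -> : w = l *: (w0 + l^-1 *: w) + (1 - l) *: (t *: - w0).
  by rewrite scalerA lE scalerDr scalerN scalerA mulfV ?gt_eqF// scale1r addrAC subrr add0r.
apply: closure_convex => //; first by rewrite l0.
  by apply: ball_r; rewrite normrZ gtr0_norm ?invr_gt0// ltr_pdivrMl.
exact: subset_closure.
Qed.

(** Points of the ball given by [baire_absorbing] are only approximated by values
at bounded arguments.  Following the open mapping theorem, the error is
approximated again at half the scale, and so on; convexity of [G] allows the
corrections to be added with weights [1/2, 1/4, 1/8], etc., and closedness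
gives the limit. *)
Lemma robinson_ursescu (Z W : completeNormedModType R) (G : set (Z * W)) (z0 : Z) :
  closed G -> convex G -> G (z0, 0) ->
  (forall w, exists2 t : R, 0 < t & exists z, G (z, t *: w)) ->
  exists2 rho : R, 0 < rho &
    forall w, `|w| < rho -> exists2 z, `|z - z0| <= 1 & G (z, w).
Proof.
move=> clG cG G0 absG.
pose F := [set w | exists2 z, `|z - z0| <= 1 & G (z, w)].
have F0 : F 0 by exists z0; rewrite ?subrr ?normr0.
have cF : convex F.
  move=> t x y /[dup] t01 /andP[t0 t1] [z1 n1 Gx] [z2 n2 Gy].
  exists (t *: z1 + (1 - t) *: z2); last exact: (cG _ _ _ t01 Gx Gy).
  rewrite convex_comb_sub (le_trans (ler_normD _ _))// !normrZ !gtr0_norm ?subr_gt0//.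
  by nra.
have absF w : exists2 t : R, 0 < t & F (t *: w).
  have [t t0 [z Gz]] := absG w.
  pose l := (1 + `|z - z0|)^-1.
  have l0 : 0 < l by rewrite invr_gt0 ltr_wpDr.
  have l1 : l <= 1 by rewrite invf_le1 ?ltr_wpDr// lerDl.
  exists (l * t); first by rewrite mulr_gt0.
  exists (z0 + l *: (z - z0)).
    rewrite addrAC subrr add0r normrZ gtr0_norm// /l ler_pdivrMl ?ltr_wpDr// mulr1.
    by rewrite lerDr.
  have := @convex_segment _ G (z0, 0) (z, t *: w) l cG G0 Gz.
  rewrite (ltW l0) l1 => /(_ isT); congr G; congr pair => /=.
  by rewrite subr0 add0r scalerA.
have [rho rho0 clF] := baire_absorbing cF F0 absF.
have [phi phiP] : exists phi : W -> Z * W, forall w, `|w| < rho ->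
    [/\ `|(phi w).1 - z0| <= 1, G (phi w) & `|w - (phi w).2| < rho / 2].
  have H w : exists p : Z * W, `|w| < rho ->
      [/\ `|p.1 - z0| <= 1, G p & `|w - p.2| < rho / 2].
    have [wr|] := boolP (`|w| < rho); last by exists (z0, 0).
    have [y [z zn Gz] wy] := (closureP_norm _ _).1 (clF _ wr) _ (divr_gt0 rho0 (ltr0n _ 2)).
    by exists (z, y).
  by have [phi phiP] := choice H; exists phi.
exists (rho / 2) => [|w wr]; first by rewrite divr_gt0.
(* [r n] is the error left after [n] corrections, rescaled to the ball of
   radius [rho]; [p n] is [p0] plus the first [n] weighted corrections. *)
pose r := fix r n := if n is n'.+1 then 2 *: (r n' - (phi (r n')).2) else 2 *: w.
have r_lt n : `|r n| < rho.
  have E a : `|2 *: a| = 2 * `|a| :> R by rewrite normrZ normr_nat.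
  elim: n => [|n IH] /=; rewrite E; first by move: wr; lra.
  by have [_ _] := phiP _ IH; lra.
pose c n : R := 2^-1 ^+ n.
have c0 n : 0 < c n by rewrite exprn_gt0 ?invr_gt0.
have cS n : c n.+1 = c n / 2 by rewrite /c exprSr.
pose p0 : Z * W := (z0, 0).
pose p := fix p n := if n is n'.+1 then p n' + c n *: (phi (r n') - p0) else p0.
have pE n : p n.+1 = p n + c n.+1 *: (phi (r n) - p0) by [].
have cvg_c : c @ \oo --> (0 : R).
  by apply: cvg_expr; rewrite ger0_norm ?invr_ge0// invf_lt1 ?ltr1n.
have pr n : w - (p n).2 = c n.+1 *: r n.
  elim: n => [|n IH].
    by rewrite /= subr0 /c expr1 scalerA mulVf ?pnatr_eq0// scale1r.
  rewrite pE /= subr0 opprD addrA IH -scalerBr scalerA.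
  by congr (_ *: _); rewrite [in RHS]cS divfK ?pnatr_eq0.
(* The weight [c n] not yet spent on corrections may go to any point of [G]. *)
have pG n q : G q -> G (p n + c n *: (q - p0)).
  elim: n q => [|n IH] q Gq; first by rewrite /= /c expr0 scale1r addrC subrK.
  have [_ Gphi _] := phiP _ (r_lt n).
  have half01 : 0 < (2^-1 : R) < 1 by apply/andP; split; lra.
  have := IH _ (cG _ _ _ half01 Gphi Gq).
  have -> : 1 - 2^-1 = 2^-1 :> R by field.
  rewrite -scalerDr; congr G; rewrite pE -addrA; congr (_ + _).
  rewrite -scalerDr addrACA -opprD.
  have -> : p0 + p0 = 2 *: p0 by rewrite scaler_nat mulr2n.
  rewrite cS -scalerA; congr (_ *: _).
  by rewrite [RHS]scalerBr scalerA mulVf ?pnatr_eq0// scale1r.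
have p1_cauchy n m : (n <= m)%N -> `|(p m).1 - (p n).1| <= c n.
  move=> nm; suff : `|(p m).1 - (p n).1| <= c n - c m by have := c0 m; lra.
  elim: m nm => [|m IH]; first by rewrite leqn0 => /eqP ->; rewrite !subrr normr0.
  rewrite leq_eqVlt => /predU1P[->|/IH le]; first by rewrite !subrr normr0.
  have [phi1 _ _] := phiP _ (r_lt m).
  rewrite pE /= addrAC (le_trans (ler_normD _ _))// normrZ gtr0_norm//.
  by have := c0 m; rewrite cS; nra.
have [z zl zn] := cvg_of_modulus cvg_c p1_cauchy.
exists z; first by have := zn 0; rewrite /c expr0.
have wl : (fun n => (p n).2) @ \oo --> w.
  apply/cvgrPdist_le => e e0.
  have [N _ NP] := cvgr_lt _ cvg_c _ (divr_gt0 e0 rho0).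
  exists N => // n /NP /=; rewrite ltr_pdivlMr// => cn; rewrite pr normrZ gtr0_norm//.
  by have := r_lt n; have := c0 n; have := normr_ge0 (r n); rewrite cS; nra.
apply: (@closed_cvg _ _ \oo _ p) clG _ _ _.
  by apply: nearW => n; have := pG n p0 G0; rewrite subrr scaler0 addr0.
have -> : p = (fun n => ((p n).1, (p n).2)).
  by apply/funext => n; rewrite -surjective_pairing.
exact: (cvg_pair zl wl).
Qed.

Lemma norm_bounded_continuous (X Y : normedModType R) (A : {linear X -> Y}) :
  (exists M : R, forall x, `|A x| <= M * `|x|) -> continuous A.
Proof.
move=> [M AM]; apply/linear_bounded_continuous/linear_boundedP.
near=> r => x; apply: (le_trans (AM x)); apply: ler_wpM2r => //.
Unshelve. all: by end_near. Qed.

(** Pull [G] back along the orthogonal projection onto [L]; the range of the pulled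
back multifunction absorbs the whole space. *)
Lemma robinson_ursescu_subspace (Z : completeNormedModType R) (W : hilbertType R)
    (L : set W) (G : set (Z * W)) (z0 : Z) :
  closed_subspace L -> closed G -> convex G -> G (z0, 0) ->
  (forall w, L w -> exists2 t : R, 0 < t & exists z, G (z, t *: w)) ->
  exists2 rho : R, 0 < rho &
    forall w, L w -> `|w| < rho -> exists2 z, `|z - z0| <= 1 & G (z, w).
Proof.
move=> sL clG cG G0 absG.
have [P [LP PL Ple]] := orthogonal_projection sL.
have Pcont : continuous P.
  by apply: norm_bounded_continuous; exists 1 => x; rewrite mul1r.
pose GP := [set p : Z * W | G (p.1, P p.2)].
have [||||rho rho0 H] := @robinson_ursescu Z W GP z0.
- apply: (@preimage_closed _ _ (fun p : Z * W => (p.1, P p.2)) G) => // p _.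
  apply: cvg_pair; first exact: cvg_fst.
  by apply: (cvg_comp _ _ cvg_snd); exact: Pcont.
- move=> t x y t01 Gx Gy; have := cG _ _ _ t01 Gx Gy; congr G; congr pair.
  by rewrite /= linearD !linearZ.
- by rewrite /GP /= linear0.
- move=> w; have [t t0 [z Gz]] := absG _ (LP w).
  by exists t => //; exists z; rewrite /GP /= linearZ.
exists rho => // w Lw /H[z zn]; rewrite /GP /= PL//.
by exists z.
Qed.

End OpenMapping.

(** * Strong relative interior and bounded linear regularity *)

Section StrongRelativeInterior.
Context {R : realType}.

Lemma lin_span_submod (V : hilbertType R) (M : set V) :
  submod_closed [in lin_span M].
Proof.
split=> [|a u v]; rewrite !inE.
  by move=> S [[/set_mem S0 _] _].
move=> Mu Mv S SM; have [[_ linS] _] := SM.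
by have := linS a u v; rewrite !inE; apply; [exact: Mu|exact: Mv].
Qed.

Lemma closure_subspace (V : hilbertType R) (M : set V) :
  submod_closed [in M] -> closed_subspace (closure M).
Proof.
move=> [/set_mem M0 linM]; split; first exact: closed_closure.
split=> [|a u v]; rewrite !inE; first exact: subset_closure.
move=> /closureP_norm clu /closureP_norm clv; apply/closureP_norm => e e0.
have a1 : 0 < `|a| + 1 by rewrite ltr_wpDl.
have [u' Mu' uu'] := clu _ (divr_gt0 (divr_gt0 e0 (ltr0n _ 2)) a1).
have [v' Mv' vv'] := clv _ (divr_gt0 e0 (ltr0n _ 2)).
exists (a *: u' + v').
  by have := linM a u' v'; rewrite !inE; exact.
rewrite opprD addrACA -scalerBr (le_lt_trans (ler_normD _ _))// normrZ.
move: uu'; rewrite ltr_pdivlMr// => uu'.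
by have := normr_ge0 (u - u'); nra.
Qed.

(** The cone identity defining [sri] makes every vector of the closed span of [M]
a positive multiple of a point of [M]; this is the absorption hypothesis of
[robinson_ursescu_subspace]. *)
Lemma sri_subspace (V : hilbertType R) (M : set V) : sri M 0 ->
  exists L : set V, [/\ closed_subspace L, M `<=` L, M 0 &
    forall w, L w -> exists2 t : R, 0 < t & M (t *: w)].
Proof.
rewrite /sri /=; have -> : [set c - 0 | c in M] = M.
  by under eq_imagel do rewrite subr0; exact: image_id.
move=> [M0 coneM]; exists (closure (lin_span M)); split => //.
- exact/closure_subspace/lin_span_submod.
- by apply: subset_trans (@subset_closure _ _) => x Mx S [_]; exact.
- rewrite -coneM => w [t /= t0 [d Md <-]].
  by exists t^-1; rewrite ?invr_gt0// scalerA mulVf ?gt_eqF// scale1r.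
Qed.

Lemma subspaceZ (V : hilbertType R) (L : set V) a u :
  closed_subspace L -> L u -> L (a *: u).
Proof.
move=> [_ [/set_mem L0 linL]] Lu.
by have := linL a u 0; rewrite !inE addr0; apply.
Qed.

(** A multiple of [w] pointing backwards, inside the ball of radius [rho], together
with the weight [l] that balances it against [w].  The last equation makes [l] of
the order of [|w|], which is what turns a qualitative ball into a linear bound. *)
Lemma opposite_vector (V : normedModType R) (w : V) (rho : R) :
  w != 0 -> 0 < rho ->
  exists a l : R, [/\ `|a *: w| < rho, 0 < l < 1,
    l *: (a *: w) + (1 - l) *: w = 0 & l = 2 * `|w| / rho * (1 - l)].
Proof.
move=> w0 rho0; have nw : 0 < `|w| by rewrite normr_gt0.
have s0 : 0 < 2 * `|w| + rho by rewrite addr_gt0 ?mulr_gt0.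
have sU : 2 * `|w| + rho != 0 by rewrite gt_eqF.
have rU : rho != 0 by rewrite gt_eqF.
have wU : `|w| != 0 by rewrite gt_eqF.
exists (- (rho / (2 * `|w|))), (2 * `|w| / (2 * `|w| + rho)); split.
- rewrite normrZ normrN gtr0_norm ?divr_gt0 ?mulr_gt0//.
  have -> : rho / (2 * `|w|) * `|w| = rho / 2 by field.
  by lra.
- by rewrite divr_gt0 ?mulr_gt0//= ltr_pdivrMr// mul1r ltrDl.
- rewrite scalerA -scalerDl.
  by rewrite [X in X *: _](_ : _ = 0) ?scale0r//; field; rewrite ?wU ?sU.
- by field; rewrite ?rU ?sU.
Qed.

(** Given [c] in [C] and [d] in [D] close to [x], the difference [c - d] can be
cancelled by a small weight on a difference [c' - d'] of bounded elements of [C]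
and [D], which exists by the Robinson-Ursescu theorem applied to
[w |-> {c in C | c - w in D}].  The resulting convex combination is a common
point of [C] and [D] at distance of order [delta] from [x]. *)
Lemma bounded_regularity (V : hilbertType R) (C D : set V) (M : R) :
  closed C -> closed D -> convex C -> convex D ->
  sri (minkowski_sub C D) 0 ->
  exists2 kappa : R, 0 < kappa & forall x c d delta,
    `|x| <= M -> C c -> D d -> `|x - c| <= delta -> `|x - d| <= delta ->
    exists2 z, C z /\ D z & `|x - z| <= kappa * delta.
Proof.
move=> clC clD cC cD /sri_subspace[L [sL ML [z0 Cz0 [d0 Dd0 zd0]] absL]].
have {d0 Dd0 zd0} Dz0 : D z0.
  by move/eqP: zd0; rewrite subr_eq0 => /eqP ->.
pose G := [set p : V * V | C p.1 /\ D (p.1 - p.2)].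
have [||||rho rho0 H] := @robinson_ursescu_subspace _ V V L G z0 sL.
- apply: closedI.
    by apply: (@preimage_closed _ _ fst C) => // p _; exact: cvg_fst.
  apply: (@preimage_closed _ _ (fun p : V * V => p.1 - p.2) D) => // p _.
  by apply: cvgB; [exact: cvg_fst|exact: cvg_snd].
- move=> t p q t01 [Cp Dp] [Cq Dq]; split; first exact: cC.
  have := cD _ _ _ t01 Dp Dq; congr D.
  by rewrite !scalerBr addrACA -opprD.
- by split => //=; rewrite subr0.
- move=> w /absL[t t0 [c Cc [d Dd cd]]].
  by exists t => //; exists c; split => //=; rewrite -cd opprB addrC subrK.
pose k := 4 / rho * (2 + `|M| + `|z0|).
have k0 : 0 <= k by rewrite mulr_ge0 ?divr_ge0 ?ltW// !addr_ge0.
exists (1 + k + `|M| + `|z0|) => [|x c d delta xM Cc Dd xc xd].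
  by have := normr_ge0 M; have := normr_ge0 z0; lra.
have delta0 : 0 <= delta by exact: le_trans xc.
have := normr_ge0 M; have := normr_ge0 z0 => z0_ge0 M_ge0.
have xM' := le_trans xM (ler_norm M).
(* For large [delta] the fixed common point [z0] is close enough. *)
have [d1|d1] := leP 1 delta.
  exists z0 => //; apply: (le_trans (ler_normB _ _)).
  by nra.
have kd0 : 0 <= k * delta by rewrite mulr_ge0.
have wn : `|c - d| <= 2 * delta.
  have -> : c - d = (x - d) - (x - c) by rewrite [RHS]addrC opprB addrA subrK.
  by apply: (le_trans (ler_normB _ _)); lra.
have [w0|w0] := eqVneq (c - d) 0.
  exists c; last by nra.
  by split => //; rewrite (subr0_eq w0).
have [a [l [un /[dup] l01 /andP[l0 l1] bal lE]]] := opposite_vector w0 rho0.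
have Lw : L (c - d) by apply: ML; exists c => //; exists d.
have [c' c'n [/= Cc' Dc']] := H _ (subspaceZ a sL Lw) un.
exists (l *: c' + (1 - l) *: c).
  split; first exact: cC.
  have := cD _ _ _ l01 Dc' Dd; congr D.
  apply/esym/subr0_eq; rewrite opprD addrACA -!scalerBr -[RHS]bal.
  by congr (_ *: _ + _); rewrite opprB addrC subrK.
have -> : x - (l *: c' + (1 - l) *: c) = (x - c) - l *: (c' - c).
  by rewrite scalerBl scale1r scalerBr addrCA opprD addrA.
apply: (le_trans (ler_normB _ _)); rewrite normrZ gtr0_norm//.
have l_le : l <= 4 / rho * delta.
  rewrite lE; apply: (@le_trans _ _ (2 * `|c - d| / rho)).
    by rewrite ler_piMr ?divr_ge0 ?mulr_ge0 ?(ltW rho0)//; lra.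
  by rewrite [leRHS]mulrAC ler_pM2r ?invr_gt0//; lra.
have c'c : `|c' - c| <= 2 + `|M| + `|z0|.
  have -> : c' - c = (c' - z0) + (z0 - x) + (x - c) by rewrite !addrA !subrK.
  apply: (le_trans (ler_normD _ _)); apply: (le_trans (lerD (ler_normD _ _) xc)).
  by have := ler_normB z0 x; lra.
have : l * `|c' - c| <= k * delta.
  rewrite /k mulrAC; apply: ler_pM => //; exact: ltW.
by nra.
Qed.

(** The open mapping theorem for an operator with closed range, seen as the
multifunction that is its own graph. *)
Lemma closed_range_lift (X Y : hilbertType R) (A : {linear X -> Y}) :
  (exists M : R, forall x, `|A x| <= M * `|x|) -> closed (range A) ->
  exists2 c : R, 0 < c & forall x y, range A y ->
    exists2 x', A x' = y & `|x - x'| <= c * `|A x - y|.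
Proof.
move=> Abnd clR; have contA := norm_bounded_continuous Abnd.
have sR : closed_subspace (range A).
  split => //; split=> [|a u v]; rewrite !inE; first by exists 0; rewrite ?linear0.
  by move=> [x _ <-] [y _ <-]; exists (a *: x + y); rewrite ?linearP.
pose G := [set p : X * Y | A p.1 - p.2 = 0].
have [||||rho rho0 H] := @robinson_ursescu_subspace _ X Y (range A) G 0 sR.
- apply: (@preimage_closed _ _ (fun p : X * Y => A p.1 - p.2) [set 0]).
    move=> p _; apply: cvgB; last exact: cvg_snd.
    by apply: (cvg_comp _ _ cvg_fst); exact: contA.
  by apply: accessible_closed_set1; apply: hausdorff_accessible; exact: norm_hausdorff.
- move=> t p q _; rewrite /G /= linearD !linearZ opprD addrACA -!scalerBr => -> ->.
  by rewrite !scaler0 addr0.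
- by rewrite /G /= linear0 subr0.
- by move=> w [x _ <-]; exists 1 => //; exists x; rewrite /G /= scale1r subrr.
exists (2 / rho) => [|x y [x0 _ x0y]]; first by rewrite divr_gt0.
have [w0|w0] := eqVneq (A x - y) 0.
  by exists x; [exact: subr0_eq|rewrite w0 subrr !normr0 mulr0].
have nw : 0 < `|A x - y| by rewrite normr_gt0.
pose s := 2 / rho * `|A x - y|.
have s0 : 0 < s by rewrite mulr_gt0 ?divr_gt0.
have Rw : range A (s^-1 *: (A x - y)).
  by exists (s^-1 *: (x - x0)) => //; rewrite linearZ (linearB A) /= x0y.
have [|z] := H _ Rw.
  have -> : rho = 2 * (s^-1 * `|A x - y|).
    by rewrite /s; field; rewrite ?(gt_eqF nw) ?(gt_eqF rho0).
  have : 0 < s^-1 * `|A x - y| by rewrite mulr_gt0 ?invr_gt0.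
  by rewrite normrZ gtr0_norm ?invr_gt0//; lra.
rewrite subr0 /G /= => z1 /subr0_eq Az.
exists (x - s *: z).
  by rewrite linearB linearZ /= Az scalerA mulfV ?gt_eqF// scale1r opprB addrC subrK.
by rewrite opprB addrC subrK normrZ gtr0_norm// -/s; nra.
Qed.

(** Three steps: from [A x] to a point of [range A] in [D] by regularity of that
pair, then back to a point of [A @^-1` D] by lifting, then to [C] by regularity
of the pair [C], [A @^-1` D]. *)
Lemma bounded_regularity_preimage (X Y : hilbertType R) (A : {linear X -> Y})
    (C : set X) (D : set Y) (M : R) :
  (exists K : R, forall x, `|A x| <= K * `|x|) -> closed (range A) ->
  closed C -> closed D -> convex C -> convex D ->
  sri (minkowski_sub C (A @^-1` D)) 0 -> sri (minkowski_sub (range A) D) 0 ->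
  exists2 kappa : R, 0 < kappa & forall x c d delta,
    `|x| <= M -> C c -> D d -> `|x - c| <= delta -> `|A x - d| <= delta ->
    exists2 z, C z /\ D (A z) & `|x - z| <= kappa * delta.
Proof.
move=> Abnd clR clC clD cC cD sriX sriY.
have [K AK] := Abnd; have contA := norm_bounded_continuous Abnd.
have clAD : closed (A @^-1` D) by apply: preimage_closed => // x _; exact: contA.
have cAD : convex (A @^-1` D).
  by move=> t x y t01 Dx Dy; rewrite /= linearD !linearZ; exact: cD.
have cR : convex (range A).
  by move=> t _ _ _ [x _ <-] [y _ <-]; exists (t *: x + (1 - t) *: y); rewrite ?linearD ?linearZ.
have [k1 k10 H1] := bounded_regularity (`|K| * M) clR clD cR cD sriY.
have [k2 k20 H2] := closed_range_lift Abnd clR.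
have [k3 k30 H3] := bounded_regularity M clC clAD cC cAD sriX.
exists (k3 * (1 + k2 * k1)) => [|x c d delta xM Cc Dd xc xd].
  by rewrite mulr_gt0// ltr_wpDr// ltW// mulr_gt0.
have delta0 : 0 <= delta by exact: le_trans xc.
have AxM : `|A x| <= `|K| * M.
  rewrite (le_trans (AK x))// (le_trans (ler_wpM2r _ (ler_norm K)))//.
  by rewrite ler_wpM2l.
have Ax0 : `|A x - A x| <= delta by rewrite subrr normr0.
have [y [Ry Dy] xy] := H1 _ _ _ _ AxM (imageT A x) Dd Ax0 xd.
have [x' Ax' xx'] := H2 x y Ry.
have k12 : 0 <= k2 * k1 * delta by rewrite !mulr_ge0// ltW.
have ADx' : (A @^-1` D) x' by rewrite /= Ax'.
have [||z Cz xz] := H3 x c x' ((1 + k2 * k1) * delta) xM Cc ADx'.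
- by lra.
- by apply: (le_trans xx'); nra.
by exists z => //; rewrite -mulrA.
Qed.

End StrongRelativeInterior.

(** * Fenchel-Rockafellar duality *)

Section Duality.
Context {R : realType} {X Y : hilbertType R}.
Variables (g : X -> \bar R) (h : Y -> \bar R) (A : {linear X -> Y}).
Hypotheses (g_Gamma0 : Gamma0 g) (h_Gamma0 : Gamma0 h).
Hypothesis A_bounded : exists M : R, forall x, `|A x| <= M * `|x|.
Local Open Scope ereal_scope.

Lemma adde_le_fin (a b : \bar R) (c : R) : a != -oo -> b != -oo ->
  a + b <= c%:E -> exists r s : R, [/\ a = r%:E, b = s%:E & (r + s <= c)%R].
Proof.
case: a => [r| |]//; case: b => [s| |]// _ _.
by rewrite -EFinD lee_fin; exists r, s.
Qed.

(** The value function of the perturbed primal problem is the infimum over [x] of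
[g x + h (A x + w)], and its convexity comes from this joint convexity in
[(x, w)]. *)
Lemma convex_perturbation x1 x2 w1 w2 (s1 s2 t : R) : (0 < t < 1)%R ->
  g x1 + h (A x1 + w1)%R <= s1%:E -> g x2 + h (A x2 + w2)%R <= s2%:E ->
  g (t *: x1 + (1 - t) *: x2)%R +
  h (A (t *: x1 + (1 - t) *: x2) + (t *: w1 + (1 - t) *: w2))%R
    <= (t * s1 + (1 - t) * s2)%:E.
Proof.
have [[gNy _] gconv _] := g_Gamma0; have [[hNy _] hconv _] := h_Gamma0.
move=> /[dup] t01 /andP[t0 t1].
move=> /(adde_le_fin (gNy _) (hNy _))[a1 [b1 [ga1 hb1 ab1]]].
move=> /(adde_le_fin (gNy _) (hNy _))[a2 [b2 [ga2 hb2 ab2]]].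
have := gconv x1 x2 t t01; rewrite ga1 ga2 => gle.
have := hconv (A x1 + w1)%R (A x2 + w2)%R t t01; rewrite hb1 hb2.
rewrite (linearD A) [A (t *: _)%R]linearZ [A ((1 - t) *: _)%R]linearZ /=.
rewrite !scalerDr addrACA => hle.
apply: (le_trans (leeD gle hle)); rewrite -!EFinM -!EFinD lee_fin.
by nra.
Qed.

Lemma closed_perturbation (c : R) :
  closed [set p : X * Y | g p.1 + h (A p.1 + p.2)%R <= c%:E].
Proof.
have [[gNy _] _ glsc] := g_Gamma0; have [[hNy _] _ hlsc] := h_Gamma0.
rewrite -openC openE => -[x w] /= /negP; rewrite -ltNge => clt.
have [a [b [ag bh cab]]] : exists a b : R,
    [/\ a%:E < g x, b%:E < h (A x + w)%R & (c <= a + b)%R].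
  move: clt (gNy x) (hNy (A x + w)%R).
  case: (g x) => [r| |]//; case: (h _) => [s| |]// clt _ _.
  - exists (r - (r + s - c) / 2)%R, (s - (r + s - c) / 2)%R.
    by move: clt; rewrite -EFinD !lte_fin => clt; split; lra.
  - by exists (r - 1)%R, (c - r + 1)%R; rewrite !lte_fin ltry; split=> //; lra.
  - by exists (c - s + 1)%R, (s - 1)%R; rewrite !lte_fin ltry; split=> //; lra.
  - by exists c, 0%R; rewrite !ltry addr0.
have [U Ux Ug] := glsc _ _ ag; have [V Vx Vh] := hlsc _ _ bh.
have cont : (fun p : X * Y => A p.1 + p.2)%R @ nbhs (x, w) --> (A x + w)%R.
  apply: cvgD; last exact: cvg_snd.
  by apply: (cvg_comp _ _ cvg_fst); exact: norm_bounded_continuous.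
have contx : fst @ nbhs (x, w) --> x by exact: cvg_fst.
have nU : nbhs (x, w) (fst @^-1` U) := contx _ Ux.
have nV : nbhs (x, w) ((fun p : X * Y => A p.1 + p.2)%R @^-1` V) := cont _ Vx.
apply: filterS (filterI nU nV) => -[y v] [/= Uy Vv].
apply/negP; rewrite -ltNge; apply: (@le_lt_trans _ _ (a%:E + b%:E)).
  by rewrite -EFinD lee_fin.
by rewrite lteD ?Ug ?Vh.
Qed.

Lemma weak_duality (x : X) (v : Y) (m : R) : g x + h (A x) <= m%:E ->
  (- m)%:E <= conjugate g (adjoint A v) + conjugate h (- v)%R.
Proof.
have [[gNy _] _ _] := g_Gamma0; have [[hNy _] _ _] := h_Gamma0.
move=> /(adde_le_fin (gNy _) (hNy _))[a [b [ga hb ab]]].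
have := leeD (conjugate_ge g (adjoint A v) x) (conjugate_ge h (- v)%R (A x)).
rewrite ga hb -!EFinB -EFinD; apply: le_trans; rewrite lee_fin.
by rewrite innerNl (innerC v) (adjointP A_bounded) (innerC x); lra.
Qed.

(** [E] is essentially the epigraph of the value function minus [m].  The
qualification condition and the Robinson-Ursescu theorem, applied to a sublevel
set of the perturbation, bound the value function above by [m + 1] near the
origin of [L].  Convexity converts this into the lower bound [- (2 / rho) |w|],
so that the value function has a subgradient [v] at the origin; its opposite is
a dual solution. *)
Lemma strong_duality (xbar : X) (m : R) :
  g xbar + h (A xbar) = m%:E -> (forall x, m%:E <= g x + h (A x)) ->
  sri (minkowski_sub (edom h) (A @` edom g)) 0%R ->
  exists v, conjugate g (adjoint A v) + conjugate h (- v)%R <= (- m)%:E.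
Proof.
have [[gNy _] _ _] := g_Gamma0; have [[hNy _] _ _] := h_Gamma0.
move=> fxbar minf /sri_subspace[L [sL ML _ absL]].
pose G := [set p : X * Y | g p.1 + h (A p.1 + p.2)%R <= (m + 1)%:E].
pose E := [set p : Y * R | exists x, g x + h (A x + p.1)%R <= (m + p.2)%:E].
have Ege0 s : E ((0 : Y)%R, s) -> (0 <= s)%R.
  move=> [x /=]; rewrite addr0 => /(le_trans (minf x)).
  by rewrite lee_fin; lra.
have EL p : E p -> L p.1.
  move=> [x /(adde_le_fin (gNy _) (hNy _))[a [b [ga hb _]]]].
  apply: ML; exists (A x + p.1)%R; first by rewrite /edom /= hb ltry.
  exists (A x); first by exists x => //; rewrite /edom /= ga ltry.
  by rewrite addrC addKr.
have Econv : convex_pair E.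
  move=> p q t t01 [x Ex] [y Ey]; exists (t *: x + (1 - t) *: y)%R.
  have := convex_perturbation t01 Ex Ey; congr (_ <= _%:E) => /=; ring.
have E00 : E ((0 : Y)%R, (0 : R)%R) by exists xbar; rewrite /= !addr0 fxbar.
have [||||rho rho0 H] := @robinson_ursescu_subspace _ X Y L G xbar sL.
- exact: closed_perturbation.
- move=> t p q t01 Gp Gq; have := convex_perturbation t01 Gp Gq.
  congr (_ <= _%:E); ring.
- by rewrite /G /= addr0 fxbar lee_fin; lra.
- move=> w /absL[t t0 [y hy [_ [x gx <-] yx]]].
  have [s Exs] : exists s : R, g x + h (A x + t *: w)%R <= (m + s)%:E.
    rewrite -yx (addrC (A x)) subrK; move: gx hy (gNy x) (hNy y); rewrite /edom /=.
    case: (g x) => [a| |]//; case: (h y) => [b| |]// _ _ _ _.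
    by exists (a + b - m)%R; rewrite -EFinD lee_fin; lra.
  (* Small enough to bring the value [m + s] below [m + 1] by mixing with
     [xbar]. *)
  pose l : R := ((2 + `|s|)^-1)%R.
  have s2 : (0 < 2 + `|s|)%R by rewrite ltr_wpDr.
  have l0 : (0 < l)%R by rewrite invr_gt0.
  have l1 : (l < 1)%R by rewrite invf_lt1//; have := normr_ge0 s; lra.
  exists (l * t)%R; first by rewrite mulr_gt0.
  exists (l *: x + (1 - l) *: xbar)%R.
  have Exbar : g xbar + h (A xbar + 0)%R <= (m + 0)%:E by rewrite !addr0 fxbar.
  have l01 : (0 < l < 1)%R by rewrite l0.
  have := convex_perturbation l01 Exs Exbar.
  rewrite scaler0 addr0 scalerA => /le_trans; apply; rewrite lee_fin.
  have : (l * s <= 1)%R.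
    rewrite /l mulrC ler_pdivrMr// mul1r; have := ler_norm s; lra.
  lra.
have [|p Ep|v vP] := @linear_minorant _ _ E (2 / rho)%R _ Econv.
- by exists ((0 : Y)%R, (0 : R)%R).
- case: p Ep => w s Ews /=.
  have [w0|w0] := eqVneq w 0%R.
    by rewrite w0 in Ews *; rewrite normr0 mulr0 oppr0; exact: Ege0.
  have [a [l [un /[dup] l01 /andP[l0 l1] bal lE]]] := opposite_vector w0 rho0.
  have [z _ Gz] := H _ (subspaceZ a sL (EL _ Ews)) un.
  have Eu : E (a *: w, 1)%R by exists z.
  have := Econv _ _ _ l01 Eu Ews; rewrite /= bal => /Ege0.
  rewrite mulr1 => ge0.
  have l1' : (0 < 1 - l)%R by rewrite subr_gt0.
  by rewrite -(ler_pM2l l1'); lra.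
exists (- v)%R; rewrite opprK.
(* A bound on the sum of the two terms; the suprema are taken one after the
   other, first over [y] and then over [x]. *)
have key x y a b : g x = a%:E -> h y = b%:E ->
    (inner (adjoint A (- v)) x - a + (inner v y - b) <= - m)%R.
  move=> ga hb; have := vP (y - A x, a + b - m)%R.
  have Exy : E (y - A x, a + b - m)%R.
    by exists x; rewrite /= (addrC y) addNKr ga hb -EFinD lee_fin; lra.
  move=> /(_ Exy) /=; rewrite innerDr innerNr (innerC _ x).
  by rewrite -(adjointP A_bounded) innerNr (innerC (A x)); lra.
have [a [b [ga hb _]]] : exists a b : R,
    [/\ g xbar = a%:E, h (A xbar) = b%:E & (a + b <= m)%R].
  by apply: adde_le_fin; rewrite ?fxbar.
have hv_le x c : g x = c%:E ->
    conjugate h v <= (- m - (inner (adjoint A (- v)) x - c))%:E.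
  move=> gx; apply: ge_ereal_sup => _ [y _ <-].
  move: (hNy y) (key x y c); case: (h y) => [d| |]// _.
    by move=> /(_ _ gx erefl) le; rewrite -EFinB lee_fin; lra.
  by rewrite leNye.
have := hv_le _ _ ga; have := conjugate_ge h v (A xbar); rewrite hb -EFinB.
case: (conjugate h v) hv_le => [r| |]// hv_le _ _.
have gv_le : conjugate g (adjoint A (- v)%R) <= (- m - r)%:E.
  apply: ge_ereal_sup => _ [x _ <-].
  move: (gNy x) (hv_le x); case: (g x) => [c| |]// _.
    by move=> /(_ _ erefl); rewrite -EFinB !lee_fin; lra.
  by rewrite leNye.
apply: (le_trans (leeD2r _ gv_le)); rewrite -EFinD lee_fin; lra.
Qed.

End Duality.

(** * Distances, tilts and growth *)

Section Distance.
Context {R : realType} {V : normedModType R}.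
Implicit Types (S : set V) (x : V).
Local Open Scope ereal_scope.

Lemma edist_inf_lt S x (d : R) : edist_inf S x < d%:E ->
  exists2 s, S s & (`|x - s| < d)%R.
Proof.
move=> /ereal_inf_lt[_ [s Ss <-] /edist_lt_ball].
by rewrite -ball_normE; exists s.
Qed.

Lemma edist_inf_le S x s : S s -> edist_inf S x <= `|x - s|%:E.
Proof.
move=> Ss; apply/lee_addgt0Pr => e e0; apply: (@le_trans _ _ (edist (x, s))).
  by apply: ereal_inf_lbound; exists s.
rewrite -EFinD; apply: edist_fin; first by rewrite ltr_wpDl.
by rewrite -ball_normE /ball_/= ltrDl.
Qed.

Lemma edist_inf_fin S x : S !=set0 -> edist_inf S x \is a fin_num.
Proof.
move=> [s Ss]; rewrite ge0_fin_numE ?edist_inf_ge0//.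
by rewrite (le_lt_trans (edist_inf_le x Ss)) ?ltry.
Qed.

End Distance.

Section Tilt.
Context {R : realType} {V : hilbertType R}.
Variables (g : V -> \bar R) (w : V) (a : R).
Hypotheses (g_Gamma0 : Gamma0 g) (gw : conjugate g w = a%:E).
Local Open Scope ereal_scope.

Lemma inner_continuous (u : V) : continuous (inner u : V -> R).
Proof.
move=> x; apply/cvgrPdist_le => e e0; near=> y.
rewrite -innerNr -innerDr (le_trans (cauchy_schwarz _ _))//.
have u1 : (0 < `|u| + 1)%R by rewrite ltr_wpDl.
have : (`|x - y| <= e / (`|u| + 1))%R.
  by near: y; apply: cvgr_dist_le; [exact: cvg_id|rewrite divr_gt0].
rewrite ler_pdivlMr// => ?; have := normr_ge0 (x - y)%R; lra.
Unshelve. all: by end_near. Qed.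

Lemma closed_subdiff_conjugate : closed (subdiff (conjugate g) w).
Proof.
have [_ _ glsc] := g_Gamma0.
have -> : subdiff (conjugate g) w =
    (fun x => (x, inner w x - a)%R) @^-1` [set p : V * R | g p.1 <= p.2%:E].
  by apply/seteqP; split=> x /= /(subdiff_conjugateP _ g_Gamma0 gw).
apply: (preimage_closed _ (closed_epigraph glsc)).
move=> x _; have cx : y @[y --> x] --> x by exact: cvg_id.
have ca : (inner w y - a)%R @[y --> x] --> (inner w x - a)%R.
  by apply: cvgB; [exact: inner_continuous|exact: cvg_cst].
exact: (cvg_pair cx ca).
Qed.

Lemma convex_subdiff_conjugate : convex (subdiff (conjugate g) w).
Proof.
have [_ gconv _] := g_Gamma0.
move=> t x y /[dup] t01 /andP[t0 t1].
move=> /(subdiff_conjugateP _ g_Gamma0 gw) gx /(subdiff_conjugateP _ g_Gamma0 gw) gy.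
apply/(subdiff_conjugateP _ g_Gamma0 gw); apply: (le_trans (gconv _ _ _ t01)).
have -> : (inner w (t *: x + (1 - t) *: y) - a)%:E =
    t%:E * (inner w x - a)%:E + (1 - t)%:E * (inner w y - a)%:E.
  by rewrite -!EFinM -EFinD !inner_simp; congr _%:E; ring.
by rewrite leeD// lee_wpmul2l// lee_fin; lra.
Qed.

Lemma fenchel_young x : (- a)%:E <= g x + (inner (- w) x)%:E.
Proof.
have [[gNy _] _ _] := g_Gamma0.
have := conjugate_ge g w x; rewrite gw innerNl.
move: (gNy x); case: (g x) => [r| |]// _; last by rewrite addye// leey.
by rewrite -EFinB -EFinD !lee_fin; lra.
Qed.

(** Nonemptiness of the subdifferential makes the lower bound of [fenchel_young]
attained. *)
Lemma argmin_tilt (fu := fun x => g x + (inner (- w) x)%:E) :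
  subdiff (conjugate g) w !=set0 ->
  argmin fu = subdiff (conjugate g) w /\ ereal_inf (range fu) = (- a)%:E.
Proof.
have [[gNy _] _ _] := g_Gamma0.
have fuP x : fu x <= (- a)%:E <-> subdiff (conjugate g) w x.
  apply: iff_trans (iff_sym (subdiff_conjugateP x g_Gamma0 gw)).
  rewrite /fu innerNl; move: (gNy x); case: (g x) => [r| |]// _.
  by rewrite -EFinD !lee_fin; split; lra.
move=> [x0 /fuP fux0]; split.
  apply/seteqP; split=> [x [_ minx]|x /fuP fux].
    by apply/fuP; exact: le_trans (minx x0) fux0.
  split; first by rewrite /edom /= (le_lt_trans fux) ?ltry.
  by move=> y; exact: le_trans fux (fenchel_young y).
apply: le_anti; apply/andP; split.
  by apply: le_trans fux0; apply: ereal_inf_lbound; exists x0.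
by apply: le_ereal_inf_tmp => _ [x _ <-]; exact: fenchel_young.
Qed.

Lemma tilt_conditioned_growth (p : R) (Omega : set V) : (1 <= p)%R ->
  tilt_conditioned p g Omega -> subdiff (conjugate g) w !=set0 ->
  exists2 c : R, (0 < c)%R & forall x r, Omega x -> g x = r%:E ->
    (c * fine (edist_inf (subdiff (conjugate g) w) x) `^ p
      <= r - inner w x + a)%R.
Proof.
move=> p1 tilt C0; have [argE infE] := argmin_tilt C0.
case: (tilt (- w)%R) => /=.
  by rewrite argE => C_eq0; move: C0; rewrite C_eq0 => -[].
move=> [c c0 cP]; exists (c / p)%R.
  by rewrite divr_gt0// (lt_le_trans _ p1).
move=> x r Ox gx.
have : (Omega `&` edom (fun x => g x + (inner (- w) x)%:E)) x.
  by split=> //; rewrite /edom /= gx -EFinD ltry.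
move=> /cP; rewrite argE infE gx -{1}(fineK (edist_inf_fin x C0)).
rewrite poweR_EFin -EFinM -EFinD lee_fin innerNl; lra.
Qed.

End Tilt.

Lemma powR_raise_exponent (R : realType) (d M q p : R) :
  0 <= d <= M -> 1 <= M -> 0 < q -> q <= p -> d `^ p <= M `^ p * d `^ q.
Proof.
move=> /andP[d0 dM] M1 q0 qp.
have M0 : 0 < M by exact: lt_le_trans M1.
move: d0; rewrite le_eqVlt => /predU1P[<-|d0].
  by rewrite powR0 ?mulr_ge0 ?powR_ge0// gt_eqF// (lt_le_trans q0).
have dM0 : 0 < d / M by rewrite divr_gt0.
have -> : d `^ p = M `^ p * (d / M) `^ p.
  by rewrite -powRM ?ltW// mulrC divfK ?gt_eqF.
rewrite ler_wpM2l ?powR_ge0//; apply: (@le_trans _ _ ((d / M) `^ q)).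
  by apply: ger_powR => //; rewrite dM0 ler_pdivrMr// mul1r.
apply: ge0_ler_powR; rewrite ?nnegrE; [exact: ltW..|].
by rewrite ler_pdivrMr// ler_peMr// ltW.
Qed.

(** Both distances stay below [M], so each can be raised to the common exponent at
the price of the factor [M `^ p]; the larger one then controls [d]. *)
Lemma growth_combine (R : realType) (p1 p2 c1 c2 d1 d2 d e1 e2 M k : R) :
  1 <= p1 -> 1 <= p2 -> 0 < c1 -> 0 < c2 -> 1 <= M -> 0 < k ->
  0 <= d1 <= M -> 0 <= d2 <= M -> 0 <= d -> d <= k * Num.max d1 d2 ->
  c1 * d1 `^ p1 <= e1 -> c2 * d2 `^ p2 <= e2 ->
  (k `^ (Num.max p1 p2) * M `^ (Num.max p1 p2) * (c1^-1 + c2^-1))^-1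
    * d `^ (Num.max p1 p2) <= e1 + e2.
Proof.
move=> p11 p21 c10 c20 M1 k0 d1M d2M d0 dk h1 h2.
set p := Num.max p1 p2.
have p1p : p1 <= p by rewrite le_max lexx.
have p2p : p2 <= p by rewrite le_max lexx orbT.
have M0 : 0 < M by exact: lt_le_trans M1.
have kp0 : 0 < k `^ p by exact: powR_gt0.
have Mp0 : 0 < M `^ p by exact: powR_gt0.
have c0 : 0 < c1^-1 + c2^-1 by rewrite addr_gt0 ?invr_gt0.
have e10 : 0 <= e1 by apply: le_trans h1; rewrite mulr_ge0 ?powR_ge0 ?ltW.
have e20 : 0 <= e2 by apply: le_trans h2; rewrite mulr_ge0 ?powR_ge0 ?ltW.
have bound q c b e : 1 <= q -> q <= p -> 0 < c -> 0 <= b <= M -> c * b `^ q <= e ->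
    b `^ p <= M `^ p * (c^-1 * e).
  move=> q1 qp cp bM le; apply: (le_trans (powR_raise_exponent bM M1 _ qp)).
    exact: lt_le_trans q1.
  by rewrite ler_pM2l// ler_pdivlMl.
have b1 := bound _ _ _ _ p11 p1p c10 d1M h1.
have b2 := bound _ _ _ _ p21 p2p c20 d2M h2.
rewrite ler_pdivrMl ?mulr_gt0//.
have d1_ge0 := andP d1M; have d2_ge0 := andP d2M.
apply: (@le_trans _ _ ((k * Num.max d1 d2) `^ p)).
  apply: ge0_ler_powR => //; rewrite ?nnegrE//; last by rewrite (le_trans d0).
  by rewrite (le_trans _ p1p)// (le_trans _ p11).
rewrite powRM ?(ltW k0)//; last by rewrite le_max d1_ge0.1.
rewrite -!mulrA ler_pM2l//.
have i1 : 0 < c1^-1 by rewrite invr_gt0.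
have i2 : 0 < c2^-1 by rewrite invr_gt0.
have m1 : 0 <= c1^-1 * e2 by rewrite mulr_ge0 // ltW.
have m2 : 0 <= c2^-1 * e1 by rewrite mulr_ge0 // ltW.
have m3 : 0 <= c1^-1 * e1 by rewrite mulr_ge0 // ltW.
have m4 : 0 <= c2^-1 * e2 by rewrite mulr_ge0 // ltW.
case: (leP d1 d2) => _.
  by apply: (le_trans b2); rewrite ler_pM2l//; lra.
by apply: (le_trans b1); rewrite ler_pM2l//; lra.
Qed.

(** * Conditioning of the sum *)

Theorem theorem3p17 (R : realType) (X Y : hilbertType R)
  (g : X -> \bar R) (h : Y -> \bar R) (A : {linear X -> Y}) (Omega : set X)
  (g_Gamma0 : Gamma0 g) (h_Gamma0 : Gamma0 h)
  (A_bounded : exists M : R, forall x, `|A x| <= M * `|x|)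
  (A_closed_range : closed (range A)) :
  let f := fun x : X => (g x + h (A x))%E in
  let psi := fun v : Y => (conjugate g (adjoint A v) + conjugate h (- v)%R)%E in
  argmin f !=set0 ->
  sri (minkowski_sub (edom h) (A @` edom g)) 0 ->
  argmin psi !=set0 /\
  forall p1 p2 : R,
    (exists vbar, [/\ argmin psi vbar,
      sri (minkowski_sub (subdiff (conjugate g) (adjoint A vbar))
             (A @^-1` subdiff (conjugate h) (- vbar))) 0 &
      sri (minkowski_sub (range A) (subdiff (conjugate h) (- vbar))) 0]) ->
    1 <= p1 -> 1 <= p2 ->
    tilt_conditioned p1 g Omega ->
    tilt_conditioned p2 h (A @` Omega) ->
    forall B : set X, B `<=` Omega -> bounded_set B ->
      conditioned (Num.max p1 p2) f B.
Proof.
move=> f psi [xbar [fxbar minf]] sri_dom.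
have [[gNy _] _ _] := g_Gamma0; have [[hNy _] _ _] := h_Gamma0.
have f_fin x : edom f x -> exists r s : R, [/\ g x = r%:E & h (A x) = s%:E].
  rewrite /edom /f /=; move: (gNy x) (hNy (A x)).
  by case: (g x) => [r| |]//; case: (h (A x)) => [s| |]// _ _ _; exists r, s.
have [a [b [ga hb]]] := f_fin _ fxbar.
pose m := a + b.
have fm : f xbar = m%:E by rewrite /f ga hb.
have [v0 psi_v0] := strong_duality g_Gamma0 h_Gamma0 A_bounded fm
  (fun x => eq_ind _ (fun t => (t <= f x)%E) (minf x) _ fm) sri_dom.
have psi_ge v : ((- m)%:E <= psi v)%E.
  by apply: (weak_duality g_Gamma0 h_Gamma0 A_bounded (x := xbar)); rewrite -fm.
split.
  exists v0; split; first by rewrite /edom /= (le_lt_trans psi_v0) ?ltry.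
  by move=> v; exact: le_trans psi_v0 (psi_ge v).
move=> p1 p2 [v [[_ minv] sriX sriY]] p1_ge1 p2_ge1 tilt_g tilt_h B BO [K0 [_ BK]].
set w := adjoint A v in sriX *.
have gwNy : conjugate g w != -oo%E.
  have := conjugate_ge g w xbar; rewrite ga -EFinB.
  by case: (conjugate g w).
have hvNy : conjugate h (- v) != -oo%E.
  have := conjugate_ge h (- v) (A xbar); rewrite hb -EFinB.
  by case: (conjugate h (- v)).
have [al [be [gw hv albe]]] := adde_le_fin gwNy hvNy (le_trans (minv v0) psi_v0).
(* Strong duality bounds the dual value above by [- m], weak duality below. *)
have mE : m = - (al + be).
  have := psi_ge v; rewrite /psi -/w gw hv -EFinD lee_fin => ?; lra.
set C := subdiff (conjugate g) w in sriX.
set D := subdiff (conjugate h) (- v) in sriX sriY.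
have argmin_f z : C z -> D (A z) -> argmin f z.
  move=> /(subdiff_conjugateP _ g_Gamma0 gw) gz.
  move=> /(subdiff_conjugateP _ h_Gamma0 hv) hz.
  have fz : (f z <= m%:E)%E.
    apply: (le_trans (leeD gz hz)); rewrite -EFinD lee_fin innerNl.
    by rewrite (innerC v) (adjointP A_bounded) -/w (innerC z); lra.
  split; first by rewrite /edom /= (le_lt_trans fz) ?ltry.
  by move=> y; rewrite (le_trans fz)// -fm.
have [[z0 Cz0 [y0 Dy0 zy0]] _] := sriX.
have {y0 Dy0 zy0} Dz0 : D (A z0).
  by move/eqP: zy0; rewrite subr_eq0 => /eqP ->.
have C0 : C !=set0 by exists z0.
have D0 : D !=set0 by exists (A z0).
have argf0 : argmin f !=set0 by exists z0; exact: argmin_f.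
have [K AK] := A_bounded.
pose N := `|K0| + 1.
have BN x : B x -> `|x| <= N.
  by move=> Bx; apply: BK => //; rewrite /N; have := ler_norm K0; lra.
have [k k0 kP] := @bounded_regularity_preimage _ _ _ A C D N A_bounded
  A_closed_range (closed_subdiff_conjugate g_Gamma0 gw)
  (closed_subdiff_conjugate h_Gamma0 hv) (convex_subdiff_conjugate g_Gamma0 gw)
  (convex_subdiff_conjugate h_Gamma0 hv) sriX sriY.
have [c1 c10 c1P] := tilt_conditioned_growth g_Gamma0 gw p1_ge1 tilt_g C0.
have [c2 c20 c2P] := tilt_conditioned_growth h_Gamma0 hv p2_ge1 tilt_h D0.
(* Bounds both distances on [B], measured from [z0] and [A z0]. *)
pose T := 1 + (N + `|z0|) + `|K| * (N + `|z0|).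
set p := Num.max p1 p2.
have p_gt0 : 0 < p by rewrite lt_max (lt_le_trans _ p1_ge1).
have N0 : 0 <= N + `|z0| by rewrite !addr_ge0.
have KN0 : 0 <= `|K| * (N + `|z0|) by rewrite mulr_ge0.
have T1 : 1 <= T by rewrite /T; lra.
pose G := k `^ p * T `^ p * (c1^-1 + c2^-1).
have G0 : 0 < G.
  have T0 : 0 < T by exact: lt_le_trans T1.
  by rewrite mulr_gt0 ?addr_gt0 ?invr_gt0// mulr_gt0 ?powR_gt0.
exists (p * G^-1) => [|x [Bx fx]]; first by rewrite mulr_gt0 ?invr_gt0.
have [r [s [gx hx]]] := f_fin _ fx.
have inf_f : ereal_inf (range f) = m%:E.
  apply: le_anti; apply/andP; split; first by rewrite -fm; apply: ereal_inf_lbound; exists xbar.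
  by apply: le_ereal_inf_tmp => _ [y _ <-]; rewrite -fm.
have finC := edist_inf_fin x C0; have finD := edist_inf_fin (A x) D0.
have finf := edist_inf_fin x argf0.
rewrite inf_f [f x](_ : _ = (r + s)%:E); last by rewrite /f gx hx.
rewrite -(fineK finf) poweR_EFin -EFinM -EFinB lee_fin.
have -> : p * G^-1 / p = G^-1 by rewrite mulrC mulKf// gt_eqF.
have -> : r + s - m = (r - inner w x + al) + (s - inner (- v) (A x) + be).
  rewrite mE innerNl (innerC v) (adjointP A_bounded) -/w (innerC x); lra.
have xz0 : `|x - z0| <= N + `|z0|.
  by rewrite (le_trans (ler_normB _ _))// lerD2r BN.
have d1T : 0 <= fine (edist_inf C x) <= T.
  rewrite fine_ge0 ?edist_inf_ge0//= -lee_fin fineK//.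
  by rewrite (le_trans (edist_inf_le x Cz0))// lee_fin /T; lra.
have d2T : 0 <= fine (edist_inf D (A x)) <= T.
  rewrite fine_ge0 ?edist_inf_ge0//= -lee_fin fineK//.
  rewrite (le_trans (edist_inf_le (A x) Dz0))// lee_fin -linearB.
  rewrite (le_trans (AK _))// (le_trans (ler_wpM2r _ (ler_norm K)))//.
  have : `|K| * `|x - z0| <= `|K| * (N + `|z0|) by rewrite ler_wpM2l.
  by rewrite /T; lra.
apply: growth_combine d1T d2T _ _ (c1P _ _ (BO _ Bx) gx) (c2P _ _ _ hx) => //.
- by rewrite fine_ge0 ?edist_inf_ge0.
- rewrite -ler_pdivrMl//; apply/ler_addgt0Pr => e e0; set delta := _ + e.
  have : Num.max (fine (edist_inf C x)) (fine (edist_inf D (A x))) < delta.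
    by rewrite ltrDl.
  rewrite gt_max => /andP[]; rewrite -!lte_fin !fineK//.
  move=> /edist_inf_lt[c Cc xc] /edist_inf_lt[d Dd xd].
  have [z [Cz Dz] xz] := kP x c d delta (BN _ Bx) Cc Dd (ltW xc) (ltW xd).
  rewrite ler_pdivrMl// (le_trans _ xz)// -lee_fin fineK//.
  by apply: edist_inf_le; exact: argmin_f.
- by exists x => //; exact: BO.
Qed.
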